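(* Let $\mu$ be a Borel probability measure on $\mathbb{R}$ whose support is compact and infinite, and let $(f_n)_{n=1}^\infty$ be a sequence of nonlinear polynomials with complex coefficients, $\deg f_n=d_n\geq 2$. For $m\in\mathbb{N}$ let $F_m:=f_m\circ f_{m-1}\circ\dots\circ f_1$ and let $\tau_m$ be the leading coefficient of $F_m$. Assume that there exists $s_0\in\mathbb{N}$ such that $f_l'(0)=0$ for all $l>s_0$, and that $P_{d_1\cdots d_m}(\cdot;\mu)=F_m(\cdot)/\tau_m$ for all $m\in\mathbb{N}$. Then for all $k,k'\in\mathbb{N}_0$ with $k>k'$, $$d\big(Z_{d_1\cdots d_{s_0+k}}(\mu),\,Y_{d_1\cdots d_{s_0+k}}(\mu)\big)\leq d\big(Z_{d_1\cdots d_{s_0+k}}(\mu),\,Z_{d_1\cdots d_{s_0+k'}}(\mu)\big).$$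
   Context: $\mathbb{N}=\{1,2,\dots\}$ and $\mathbb{N}_0=\mathbb{N}\cup\{0\}$. For a Borel probability measure $\mu$ on $\mathbb{R}$ with infinite compact support, $P_n(\cdot;\mu)$ denotes the $n$-th monic orthogonal polynomial for $\mu$, i.e. the monic polynomial of degree $n$ minimizing $\int|Q(x)|^2\,d\mu(x)$ among all monic polynomials $Q$ of degree $n$ (equivalently, orthogonal in $L_2(\mu)$ to all polynomials of degree less than $n$). Put $Z_n(\mu):=\{x: P_n(x;\mu)=0\}$ and $Y_n(\mu):=\{x: P_n'(x;\mu)=0\}$. For $A,B\subset\mathbb{C}$, $d(A,B)=\inf_{a\in A,\,b\in B}|a-b|$ is the Euclidean distance between the sets. The subscript $d_1\cdots d_m$ is the product of the degrees $d_1,\dots,d_m$. *)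

(* Defs.v *)
From HB Require Import structures.
From mathcomp Require Import all_boot all_order all_algebra.
From mathcomp Require Import all_classical all_reals all_analysis.
From mathcomp Require Import complex.

Set Implicit Arguments.
Unset Strict Implicit.
Unset Printing Implicit Defensive.

Import Order.TTheory GRing.Theory Num.Theory.
Import numFieldNormedType.Exports.

Local Open Scope classical_set_scope.
Local Open Scope complex_scope.
Local Open Scope ring_scope.

(* [`|z|] lives in R[i], where it has zero imaginary part. *)
Definition cabs (R : realType) (z : R[i]) : R := complex.Re `|z|.

Definition measure_support (R : realType)
    (mu : probability (measurableTypeR R) R) : set R :=
  [set x | forall U : set R, open U -> U x -> (0 < mu U)%E].

Definition monic_of_degree (R : realType) (n : nat) (Q : {poly R[i]}) : Prop :=
  Q \is monic /\ size Q = n.+1.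

Definition sqr_L2norm (R : realType)
    (mu : probability (measurableTypeR R) R) (Q : {poly R[i]}) : \bar R :=
  (\int[mu]_x ((cabs Q.[x%:C]) ^+ 2)%:E)%E.

Definition is_monic_orthopoly (R : realType)
    (mu : probability (measurableTypeR R) R) (n : nat) (P : {poly R[i]}) : Prop :=
  monic_of_degree n P /\
  forall Q : {poly R[i]}, monic_of_degree n Q ->
    (sqr_L2norm mu P <= sqr_L2norm mu Q)%E.

(* When the support of mu is compact and infinite, there is exactly one
   polynomial satisfying [is_monic_orthopoly mu n], so that the default value 0
   is never taken. *)
Definition orthopoly (R : realType)
    (mu : probability (measurableTypeR R) R) (n : nat) : {poly R[i]} :=
  xget 0 [set P | is_monic_orthopoly mu n P].

Definition orthopoly_zeros (R : realType)
    (mu : probability (measurableTypeR R) R) (n : nat) : set R[i] :=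
  [set z | root (orthopoly mu n) z].

Definition orthopoly_critical_points (R : realType)
    (mu : probability (measurableTypeR R) R) (n : nat) : set R[i] :=
  [set z | root (orthopoly mu n)^`() z].

(* Valued in [\bar R], so that the distance to the empty set is +oo instead of
   the junk value of [inf]. *)
Definition set_dist (R : realType) (A B : set R[i]) : \bar R :=
  ereal_inf [set (cabs (a - b))%:E | a in A & b in B].

(* F_m = f_m \o ... \o f_1; the value f 0 is not used. *)
Fixpoint poly_iter (R : realType) (f : nat -> {poly R[i]}) (m : nat) :
    {poly R[i]} :=
  if m is m'.+1 then f m \Po poly_iter f m' else 'X.

Definition degree_prod (d : nat -> nat) (m : nat) : nat :=
  (\prod_(1 <= i < m.+1) d i)%N.

(* Main.v *)
Require Import Defs.
From HB Require Import structures.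
From mathcomp Require Import all_boot all_order all_algebra.
From mathcomp Require Import all_classical all_reals all_analysis.
From mathcomp Require Import complex.

Set Implicit Arguments.
Unset Strict Implicit.
Unset Printing Implicit Defensive.

Import Order.TTheory GRing.Theory Num.Theory.
Import numFieldNormedType.Exports.

Local Open Scope classical_set_scope.
Local Open Scope complex_scope.
Local Open Scope ring_scope.

(** Put [F_m := f_m \o ... \o f_1].  By the chain rule [F_m'] is the product of
    the factors [f_l' (F_(l-1))] for [l <= m].  If [F_s] vanishes at [z] for
    some [s] with [s0 <= s < m], the factor with [l = s + 1] is
    [f_(s+1)' (0) = 0], so [z] is a critical point of [F_m]
    ([root_deriv_poly_iter]).  As the orthogonal polynomials in question are
    scalar multiples of the [F_m], every zero of the one attached to
    [m = s0 + k'] is a critical point of the one attached to [m = s0 + k]: the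
    former zero set is contained in the latter critical set, and the distance
    to a smaller set can only be larger ([set_dist_subr]). *)

Lemma set_dist_subr (R : realType) (A B C : set R[i]) :
  B `<=` C -> (set_dist A C <= set_dist A B)%E.
Proof.
move=> BC; apply: le_ereal_inf => _ [a Aa [b Bb <-]].
by exists a => //; exists b => //; apply: BC.
Qed.

Lemma root_scale_lead_coefV (F : fieldType) (P : {poly F}) (z : F) :
  root ((lead_coef P)^-1 *: P) z = root P z.
Proof.
have [->|P0] := eqVneq P 0; first by rewrite scaler0.
by rewrite rootZ // invr_eq0 lead_coef_eq0.
Qed.

(** Only one factor of the chain-rule product has to vanish: it does so at the
    step from [s] to [s + 1], and the later steps merely multiply the
    derivative by further factors. *)
Lemma root_deriv_poly_iter (R : realType) (f : nat -> {poly R[i]})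
    (s m : nat) (z : R[i]) :
  (f s.+1)^`().[0] = 0 -> (s < m)%N ->
  root (poly_iter f s) z -> root (poly_iter f m)^`() z.
Proof.
move=> fs0 + /rootP Fz; elim: m => // m IHm.
rewrite ltnS leq_eqVlt => /predU1P[<-|/IHm /rootP F'z]; apply/rootP;
  rewrite /= deriv_comp hornerM horner_comp.
- by rewrite Fz fs0 mul0r.
- by rewrite F'z mulr0.
Qed.

Theorem theorem3p2 (R : realType) (mu : probability (measurableTypeR R) R)
    (f : nat -> {poly R[i]}) (d : nat -> nat) (s0 : nat)
    (mu_compact : compact (measure_support mu))
    (mu_infinite : infinite_set (measure_support mu))
    (deg_f : forall n, (1 <= n)%N -> size (f n) = (d n).+1)
    (d_ge2 : forall n, (1 <= n)%N -> (2 <= d n)%N)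
    (s0_gt0 : (1 <= s0)%N)
    (f_crit0 : forall l, (s0 < l)%N -> (f l)^`().[0] = 0)
    (orthopoly_iter : forall m, (1 <= m)%N ->
       orthopoly mu (degree_prod d m) =
         (lead_coef (poly_iter f m))^-1 *: poly_iter f m) :
  forall k k' : nat, (k' < k)%N ->
    (set_dist (orthopoly_zeros mu (degree_prod d (s0 + k)))
              (orthopoly_critical_points mu (degree_prod d (s0 + k)))
     <= set_dist (orthopoly_zeros mu (degree_prod d (s0 + k)))
                 (orthopoly_zeros mu (degree_prod d (s0 + k'))))%E.
Proof.
move=> k k' ltk; apply: set_dist_subr => z.
have idx_gt0 j : (1 <= s0 + j)%N by rewrite addn_gt0 s0_gt0.
rewrite /orthopoly_zeros /orthopoly_critical_points /= !orthopoly_iter //.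
rewrite root_scale_lead_coefV derivZ => Fz.
have /rootP F'z : root (poly_iter f (s0 + k))^`() z.
  apply: root_deriv_poly_iter Fz; last by rewrite ltn_add2l.
  by apply: f_crit0; rewrite ltnS leq_addr.
by apply/rootP; rewrite hornerZ F'z mulr0.
Qed.
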